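(* Let $m,s\in\mathbb N$, let $\mathcal F$ be a Ferrers diagram of order $s$ and let $\mathcal F^m$ be its $m$-block version. Let $\delta\in[s]$ and $d\in[sm]$ be such that $d-1=m(\delta-1)+r$ with $r\in[m-1]$. Suppose that $(\mathcal F,\delta)$ is MDS-constructible, and that one of the following holds: (1) $\delta=s$; or (2) $\delta\le s-1$ and there exists some $j\in\{0,\dots,\delta-1\}$ such that - $(\mathcal F,\delta)$ is $j$-Singleton and $(\mathcal F,\delta+1)$ is $j$-Singleton or $(j+1)$-Singleton, and - $\mathcal F\cap\mathcal S_{s,\delta,j}$ is triangular covered. Then $(\mathcal F^m,d)$ is MSRD-constructible.
   Context: Notation: $\mathbb N=\{1,2,\dots\}$ and $[n]=\{1,\dots,n\}$, $[0]=\emptyset$. A (top-right justified) Ferrers diagram of order $n$ is a subset $\mathcal F\subseteq[n]^2$ such that (1) $(i,j)\in\mathcal F$ and $j<n$ imply $(i,j+1)\in\mathcal F$; (2) $(i,j)\in\mathcal F$ and $i>1$ imply $(i-1,j)\in\mathcal F$. Write $\mathcal F=[c_1,\dots,c_n]$ where $c_j$ is the number of elements of $\mathcal F$ in column $j$. For $d\in[n]$ and $j\in\{0,\dots,d-1\}$ let $\nu_j(\mathcal F,d)=\sum_{i=1}^{n-j}\max\{0,c_i-d+1+j\}$ and $\nu_{\min}(\mathcal F,d)=\min_{0\le j\le d-1}\nu_j(\mathcal F,d)$. The pair $(\mathcal F,d)$ is $j$-Singleton if $\nu_{\min}(\mathcal F,d)=\nu_j(\mathcal F,d)$ (it may be $j$-Singleton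 for several $j\in\{0,\dots,d-1\}$). Rows $R_i=\{(i,j):j\in[n]\}$, columns $C_j=\{(i,j):i\in[n]\}$, diagonals $D_i=\{(l,n-i+l):1\le l\le i\}$ of $[n]^2$. The pair $(\mathcal F,d)$ is MDS-constructible if $\nu_{\min}(\mathcal F,d)=\sum_{i=1}^n\max\{|D_i\cap\mathcal F|-d+1,0\}$. $\mathcal S_{n,d,j}=\{(i,l)\in[n]^2: d-j\le i\le n,\ 1\le l\le n-j\}$. $\mathcal T_n=\{(i,j):i,j\in[n],\ i\le j\}$. Triangular covered: for a Ferrers diagram $\mathcal G$ of order $s$, its minimum order is $o(\mathcal G)=\max\{|R_1\cap\mathcal G|,|C_s\cap\mathcal G|\}$ and its standard version is $\mathcal G_{\mathrm{st}}=\{(i,j-(s-o(\mathcal G))):(i,j)\in\mathcal G\}\subseteq[o(\mathcal G)]^2$. $\mathcal G$ is triangular covered if $\mathcal G=\emptyset$ or $\mathcal G_{\mathrm{st}}\subseteq\mathcal T_{o(\mathcal G)}$. The set $\mathcal F\cap\mathcal S_{s,\delta,j}$ is regarded as a Ferrers diagram by translating it to the top-right corner, i.e. identifying it with $\{(i-(\delta-1-j),\,l+j):(i,l)\in\mathcal F\cap\mathcal S_{s,\delta,j}\}\subseteq[s]^2$. Blocks: $Q_{i,j}=Q_{i,j}^{(m)}:=([im]\setminus[(i-1)m])\times([jm]\setminus[(j-1)m])$. A Ferrers diagram $\mathcal G$ of order $sm$ is an $m$-block Ferrers diagram if $Q_{i,j}\cap\mathcal G\in\{\emptyset,Q_{i,j}\}$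 for all $i,j\in[s]$; its block set is $\mathbf B(\mathcal G)=\{Q_{i,j}: i,j\in[s],\ Q_{i,j}\subseteq\mathcal G\}$. Block diagonals: $D_i^B=\{Q_{l,s-i+l}:1\le l\le i\}$, $i\in[s]$. For an $m$-block diagram $\mathcal G$ of order $sm$ and $d\in[sm]$, $(\mathcal G,d)$ is MSRD-constructible if $\nu_{\min}(\mathcal G,d)=m\sum_{i=1}^s\max\{m|D_i^B\cap\mathbf B(\mathcal G)|-d+1,0\}$. The $m$-block version of a Ferrers diagram $\mathcal F$ of order $s$ is $\mathcal F^m:=\bigcup_{(i,j)\in\mathcal F}Q_{i,j}^{(m)}$. *)

(* Defs.v *)
From mathcomp Require Import all_boot.

Set Implicit Arguments.
Unset Strict Implicit.
Unset Printing Implicit Defensive.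

(* Cells of the n x n grid.  Ordinals start at 0; every formula below is       *)
(* written with the coordinates [rown] and [coln], which range over 1, ..., n. *)
Notation cell n := ('I_n * 'I_n)%type.

Definition rown (n : nat) (p : cell n) : nat := p.1.+1.
Definition coln (n : nat) (p : cell n) : nat := p.2.+1.

Section Diagrams.
Variable n : nat.
Implicit Types (F G : {set cell n}) (d i j : nat).

Definition grid_row i : {set cell n} := [set p | rown p == i].
Definition grid_col j : {set cell n} := [set p | coln p == j].
Definition grid_diag i : {set cell n} :=
  [set p | (1 <= rown p <= i) && (coln p == n - i + rown p)].

Definition ferrers F : Prop :=
  (forall p q : cell n, p \in F ->
     rown q = rown p -> coln q = coln p + 1 -> q \in F) /\
  (forall p q : cell n, p \in F ->
     rown p = rown q + 1 -> coln q = coln p -> q \in F).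

Definition colsize F j : nat := #|grid_col j :&: F|.

(* Truncated subtraction: x + 1 - d is max {0, x - d + 1}. *)
Definition nu F d j : nat :=
  \sum_(1 <= i < (n - j).+1) (colsize F i + 1 + j - d).

(* For d >= 1 the default value nu F d 0 is itself one of the terms. *)
Definition nu_min F d : nat := \big[minn/nu F d 0]_(j < d) nu F d j.

Definition singleton F d j : Prop := j < d /\ nu_min F d = nu F d j.

Definition MDS_constructible F d : Prop :=
  nu_min F d = \sum_(1 <= i < n.+1) (#|grid_diag i :&: F| + 1 - d).

Definition S_region d j : {set cell n} :=
  [set p | (d - j <= rown p <= n) && (1 <= coln p <= n - j)].

Definition T_region : {set cell n} := [set p | rown p <= coln p].

(* F :&: S_region d j moved to the top-right corner of the grid: up by         *)
(* d - 1 - j and right by j.  For j < d no cell leaves the grid.               *)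
Definition shifted_S F d j : {set cell n} :=
  [set q | [exists p in F :&: S_region d j,
     (rown q == rown p - (d - 1 - j)) && (coln q == coln p + j)]].

Definition min_order G : nat :=
  maxn #|grid_row 1 :&: G| #|grid_col n :&: G|.

End Diagrams.

(* When G is a Ferrers diagram, no cell of G is lost in the smaller grid. *)
Definition standard_version (n : nat) (G : {set cell n}) :
    {set cell (min_order G)} :=
  [set q | [exists p in G,
     (rown q == rown p) && (coln q == coln p - (n - min_order G))]].

Definition triangular_covered (n : nat) (G : {set cell n}) : Prop :=
  G = set0 \/ standard_version G \subset T_region (min_order G).

Section Blocks.
Variables m s : nat.
Implicit Types (G : {set cell (s * m)}) (d i j : nat).

Definition block i j : {set cell (s * m)} :=
  [set p | ((i - 1) * m < rown p <= i * m) && ((j - 1) * m < coln p <= j * m)].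

Definition block_ferrers G : Prop :=
  ferrers G /\
  (forall i j, 1 <= i <= s -> 1 <= j <= s ->
     block i j :&: G = set0 \/ block i j :&: G = block i j).

Definition block_set G : {set {set cell (s * m)}} :=
  [set block (rown b) (coln b) | b : cell s & block (rown b) (coln b) \subset G].

Definition block_diag i : {set {set cell (s * m)}} :=
  [set block l.+1 (s - i + l.+1) | l : 'I_i].

Definition MSRD_constructible G d : Prop :=
  block_ferrers G /\
  nu_min G d =
    m * \sum_(1 <= i < s.+1) (m * #|block_diag i :&: block_set G| + 1 - d).

Definition block_version (F : {set cell s}) : {set cell (s * m)} :=
  \bigcup_(b in F) block (rown b) (coln b).

End Blocks.

(* Main.v *)
Require Import Defs.
From mathcomp Require Import all_boot.
From mathcomp Require Import zify.

Set Implicit Arguments.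
Unset Strict Implicit.
Unset Printing Implicit Defensive.

(** Call e := delta - 1 - j, so that [nu F delta j] counts the cells of F that
survive when the top e rows and the last j columns of the grid are deleted; in
the same way [nu (block_version m F) d J] counts the cells of the block version
surviving the deletion of d - 1 - J rows and J columns.

Lower bound.  Deleting d - 1 lines from a block diagonal made of D blocks
destroys at most m (d - 1) of its D m^2 cells, because each line meets the
block diagonal in at most m cells.  Hence every [nu (block_version m F) d J] is
at least m times the sum of the max {0, m D_i - d + 1}
([diagonal_lower_bound], via [diagonal_inequality]).

Upper bound.  As d - 1 = m (e + j) + r, the deleted lines may be chosen as the
m-fold thickening of the e rows and j columns, plus r more rows or r more
columns.  Let G be the set of cells of F surviving e rows and j columns.  The
r extra rows cut m r cells out of the thickening for each cell in the first
row of G, and the r extra columns m r cells for each cell in the last column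
of G.  The better choice leaves m (m |G| - r o) cells, where o is the minimum
order of G ([nu_block_rows], [nu_block_columns], [min_order_shifted_S]).

Comparison.  Let N be the number of diagonals with D_i >= delta.  The lower
bound is m (m S - r N), where S is the sum of the max {0, D_i - delta + 1}
([sum_excess_blocks]), and S = |G| when j attains the minimum and (F, delta) is
MDS-constructible.  So everything reduces to N <= o
([count_long_diagonals]).  Deleting delta - 1 lines cannot wipe out a diagonal
with at least delta cells, so each of the N diagonals meets G
([long_diagonal_survivor]); and a triangular covered diagram of minimum order o
meets at most o diagonals.  When delta = s only the main diagonal is long
enough, so N <= 1, and if N = 1 then G is nonempty and o >= 1. *)

(** * Finite sums *)

(** The term m - (U - l * m) is what remains of the l-th of k consecutive
intervals of length m after the first U points have been removed. *)
Lemma sum_trunc_steps (m U k : nat) :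
  \sum_(l < k) (m - (U - l * m)) = k * m - U.
Proof.
elim: k => [|k IHk]; first by rewrite big_ord0 mul0n.
by rewrite big_ord_recr /= IHk mulSn; lia.
Qed.

Lemma sum_ltn_ord (n k : nat) : \sum_(x < n) (x < k) = minn n k.
Proof.
elim: n => [|n IHn]; first by rewrite big_ord0 min0n.
by rewrite big_ord_recr /= IHn; lia.
Qed.

Lemma sum_blocks (m s : nat) (h : nat -> nat) :
  \sum_(x < s * m) h x = \sum_(a < s) \sum_(u < m) h (a * m + u).
Proof.
elim: s => [|s IHs]; first by rewrite mul0n !big_ord0.
by rewrite big_ord_recr /= -IHs mulSn addnC big_split_ord.
Qed.

(** Same bookkeeping as [sum_trunc_steps], with the last J of the s * m points
removed: the factor of g a is the number of points left in the a-th interval. *)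
Lemma sum_first_columns (m s J : nat) (g : nat -> nat) : 0 < m ->
  \sum_(x < s * m - J) g (x %/ m)
  = \sum_(a < s) (m - (J - (s - a.+1) * m)) * g a.
Proof.
move=> m_gt0.
rewrite (big_ord_widen (s * m) (fun x => g (x %/ m)) (leq_subr _ _)) big_mkcond.
rewrite (sum_blocks m s (fun x => if x < s * m - J then g (x %/ m) else 0)).
apply: eq_bigr => a _.
under eq_bigr => u _.
  rewrite divnMDl // divn_small ?ltn_ord // addn0.
  have -> : (if a * m + u < s * m - J then g a else 0)
            = (u < s * m - J - a * m) * g a.
    by rewrite [in RHS]ltn_subRL; case: ifP => _; rewrite ?mul1n ?mul0n.
  over.
rewrite -big_distrl /= sum_ltn_ord; congr (_ * _).
have := mulnBl s a.+1 m; rewrite mulSn.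
have : a.+1 * m <= s * m by rewrite leq_mul2r ltn_ord orbT.
rewrite mulSn; lia.
Qed.

(** On a block diagonal of i blocks, of which those with b l belong to the
diagram, delete U rows and J columns.  In the l-th block x rows and y columns
remain, and x y >= m^2 - m (m - x) - m (m - y) because
(m - x) (m - y) >= 0.  The l-th blocks have pairwise distinct rows and columns,
so the m - x add up to at most U and the m - y to at most J. *)
Lemma diagonal_inequality (m U J i : nat) (b : nat -> bool) :
  m * (m * \sum_(l < i) b l) <=
  \sum_(l < i) b l * ((m - (J - (i - l.+1) * m)) * (m - (U - l * m)))
  + m * (U + J).
Proof.
(* Rows and columns left in the l-th block of the diagonal. *)
pose x l := m - (U - l * m); pose y l := m - (J - (i - l.+1) * m).
have termwise (l : 'I_i) :
    m * (m * b l) <= b l * (y l * x l) + (m * (m - x l) + m * (m - y l)).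
  have : x l <= m by rewrite leq_subr.
  have : y l <= m by rewrite leq_subr.
  by case: (b l); nia.
have sum_x : \sum_(l < i) (m - x l) <= U.
  have := sum_trunc_steps m U i; rewrite -/x => sx.
  have : \sum_(l < i) (m - x l) + \sum_(l < i) x l = i * m.
    rewrite -big_split /= (eq_bigr (fun _ => m)) ?sum_nat_const ?card_ord //.
    by move=> l _; rewrite subnK // leq_subr.
  rewrite sx; lia.
have sum_y : \sum_(l < i) (m - y l) <= J.
  have sy : \sum_(l < i) y l = i * m - J.
    rewrite -(sum_trunc_steps m J i) (reindex_inj rev_ord_inj) /=.
    apply: eq_bigr => l _; rewrite /y (_ : i - (i - l.+1).+1 = l) //.
    by have := ltn_ord l; lia.
  have : \sum_(l < i) (m - y l) + \sum_(l < i) y l = i * m.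
    rewrite -big_split /= (eq_bigr (fun _ => m)) ?sum_nat_const ?card_ord //.
    by move=> l _; rewrite subnK // leq_subr.
  rewrite sy; lia.
rewrite !big_distrr /=; apply: leq_trans (leq_sum _ _) _.
  by move=> l _; exact: termwise.
rewrite !big_split /= leq_add2l -!big_distrr /= -mulnDr leq_mul2l.
by rewrite leq_add ?orbT.
Qed.

(** Cells strictly below the main diagonal lie on none of the s diagonals, hence
only an inequality. *)
Lemma sum_over_diagonals (s : nat) (h : nat -> nat -> nat) :
  \sum_(i < s) \sum_(l < i.+1) h l (s - i.+1 + l)
  <= \sum_(a < s) \sum_(l < s) h l a.
Proof.
under eq_bigr => i _.
  rewrite (big_ord_widen s (fun l => h l (s - i.+1 + l)) (ltn_ord i)) big_mkcond.
  over.
rewrite exchange_big [leqRHS]exchange_big /=.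
apply: leq_sum => l _.
rewrite -big_mkcond /=.
have wid (f : nat -> nat) :
    \sum_(i < s | l < i.+1) f i = \sum_(l <= i < s) f i.
  by rewrite big_geq_mkord; apply: eq_bigl.
(* In row l the diagonals l, ..., s - 1 hit the columns s - 1, ..., l. *)
rewrite (wid (fun i => h l (s - i.+1 + l))) big_nat_rev /=.
apply: (@leq_trans (\sum_(l <= a < s) h l a)).
  rewrite big_nat_cond [leqRHS]big_nat_cond.
  apply: leq_sum => a; rewrite andbT => /andP[la as_].
  by rewrite (_ : s - (l + s - a.+1).+1 + l = a) //; lia.
rewrite -wid [leqRHS](bigID (fun a : 'I_s => l < a.+1)) /=.
exact: leq_addr.
Qed.

(** * Ferrers diagrams and their column heights *)

Lemma card_ord_ltn (n k : nat) (A : {set 'I_n}) :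
  k <= n -> (forall x : 'I_n, (x \in A) = (x < k)) -> #|A| = k.
Proof.
move=> k_le_n memA; rewrite -sum1_card big_mkcond /=.
rewrite -[RHS](minn_idPr k_le_n) -sum_ltn_ord.
by apply: eq_bigr => x _; rewrite memA; case: (x < k).
Qed.

Lemma down_closed_mem (n : nat) (A : {set 'I_n}) :
  (forall x y : 'I_n, x \in A -> y <= x -> y \in A) ->
  forall x : 'I_n, (x \in A) = (x < #|A|).
Proof.
move=> downA x.
have cardI k : k <= n -> #|[set y : 'I_n | y < k]| = k.
  by move=> k_le_n; apply: card_ord_ltn => // y; rewrite inE.
apply/idP/idP => [xA | ].
  rewrite -[X in X <= _](cardI _ (ltn_ord x)); apply/subset_leq_card/subsetP => y.
  by rewrite inE ltnS; apply: downA.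
apply: contraTT => xNA; rewrite -leqNgt -[X in _ <= X](cardI _ (ltnW (ltn_ord x))).
apply/subset_leq_card/subsetP => y yA; rewrite inE ltnNge.
by apply: contra xNA; apply: downA.
Qed.

Section FerrersFacts.
Variable n : nat.
Implicit Types (F : {set cell n}) (p q : cell n).

Lemma card_cells (K F : {set cell n}) (k : nat) (f : 'I_k -> cell n) :
  injective f -> (forall p, p \in K -> exists l, p = f l) ->
  (forall l, f l \in K) ->
  #|K :&: F| = \sum_(l < k) (f l \in F).
Proof.
move=> f_inj onto inK.
have -> : K :&: F = f @: [set l | f l \in F].
  apply/setP=> p; rewrite inE; apply/andP/imsetP.
    by case=> /onto[l ->] flF; exists l; rewrite ?inE.
  by case=> l; rewrite inE => flF ->.
rewrite card_imset // -sum1dep_card big_mkcond.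
by apply: eq_bigr => l _; case: (f l \in F).
Qed.

Lemma colsizeE F (a : 'I_n) :
  colsize F a.+1 = #|[set l : 'I_n | (l, a) \in F]|.
Proof.
rewrite /colsize (@card_cells _ _ n (fun l => (l, a))).
- rewrite -sum1dep_card [RHS]big_mkcond.
  by apply: eq_bigr => l _; case: (_ \in F).
- by move=> x y [].
- by case=> l b; rewrite inE => /eqP[/val_inj ->]; exists l.
- by move=> l; rewrite inE.
Qed.

Lemma ferrers_closed F p q :
  ferrers F -> p \in F -> q.1 <= p.1 -> p.2 <= q.2 -> q \in F.
Proof.
case: p q => [l a] [l' a'] /= [right up] laF l'_le a_le.
have {laF a_le} : (l, a') \in F.
  move: a_le; case: a' => a'.
  elim: a' => [|a' IHa] a'n; rewrite /= leq_eqVlt.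
    by rewrite ltn0 orbF => /eqP a0; rewrite (_ : Ordinal _ = a) //; apply: val_inj.
  case/orP=> [/eqP a0 | ].
    by rewrite (_ : Ordinal _ = a) //; apply: val_inj.
  rewrite ltnS => aa'; apply: (right (l, Ordinal (ltnW a'n))) => //.
    exact: IHa.
  by rewrite /coln /= addn1.
have [k] := ubnP (l - l'); elim: k l l'_le => // k IHk l l'_le.
case: (ltngtP l' l) l'_le => // [lt _ dk laF | /val_inj -> //].
have l1n : l.-1 < n by apply: leq_ltn_trans (leq_pred _) (ltn_ord l).
apply: (IHk (Ordinal l1n)) => /=; [lia | lia | ].
by apply: (up (l, a')) => //; rewrite /rown /=; lia.
Qed.

(** Each column of a Ferrers diagram is an initial segment, so the column heights
determine the diagram; everything below is computed from them. *)
Lemma mem_ferrers F p :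
  ferrers F -> (p \in F) = (p.1 < colsize F p.2.+1).
Proof.
move=> ferF; case: p => l a /=; rewrite colsizeE.
rewrite -down_closed_mem ?inE // => x y; rewrite !inE => xF yx.
exact: ferrers_closed xF _ _.
Qed.

Lemma colsize_le F (a : 'I_n) : colsize F a.+1 <= n.
Proof. by rewrite colsizeE -[X in _ <= X]card_ord max_card. Qed.

Lemma colsize_homo F (a b : 'I_n) :
  ferrers F -> a <= b -> colsize F a.+1 <= colsize F b.+1.
Proof.
move=> ferF ab; rewrite !colsizeE; apply/subset_leq_card/subsetP => l.
by rewrite !inE => lF; apply: ferrers_closed lF _ _.
Qed.

Lemma card_grid_diag F i :
  ferrers F -> i <= n ->
  #|grid_diag n i :&: F| = \sum_(l < i) (l < colsize F (n - i + l).+1).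
Proof.
move=> ferF i_le_n.
have rowP (l : 'I_i) : l < n by apply: leq_trans (ltn_ord l) _.
have colP (l : 'I_i) : n - i + l < n by have := ltn_ord l; lia.
rewrite (@card_cells _ _ i (fun l => (Ordinal (rowP l), Ordinal (colP l)))).
- by apply: eq_bigr => l _; rewrite mem_ferrers.
- by move=> x y [] /val_inj.
- case=> l a; rewrite inE /rown /coln /= => /andP[li /eqP ai].
  by exists (Ordinal li); congr pair; apply: val_inj => //=; lia.
- by move=> l; rewrite inE /rown /coln /= ltn_ord addnS eqxx.
Qed.

Lemma nu_min_le F d j : j < d -> nu_min F d <= nu F d j.
Proof.
move=> jd; rewrite /nu_min.
have := mem_index_enum (Ordinal jd); elim: index_enum => // k r IHr.
rewrite inE big_cons geq_min => /predU1P[<- | /IHr ->]; first by rewrite leqnn.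
exact: orbT.
Qed.

Lemma nu_min_attained F d :
  0 < d -> exists2 j, j < d & nu_min F d = nu F d j.
Proof.
move=> d_gt0; rewrite /nu_min.
elim/big_rec: _ => [|j x _ [k kd ->]]; first by exists 0.
by rewrite /minn; case: ifP => _; [exists j | exists k].
Qed.

End FerrersFacts.

(** * Block versions *)

Section BlockVersion.
Variables m s : nat.
Hypothesis m_gt0 : 0 < m.
Implicit Types (F : {set cell s}) (p : cell (s * m)).

Lemma block_index_proof (x : 'I_(s * m)) : x %/ m < s.
Proof. by rewrite ltn_divLR. Qed.

Definition block_index (x : 'I_(s * m)) : 'I_s := Ordinal (block_index_proof x).

Lemma block_index_eq (x : 'I_(s * m)) (l : 'I_s) :
  x %/ m = l -> block_index x = l.
Proof. by move=> eq_l; apply: ord_inj. Qed.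

Lemma mem_block i j p :
  (p \in block m s i.+1 j.+1) = (p.1 %/ m == i) && (p.2 %/ m == j).
Proof.
have interval (x k : nat) :
    ((k.+1 - 1) * m < x.+1 <= k.+1 * m) = (x %/ m == k).
  by rewrite subn1 ltnS /= -leq_divRL // -ltn_divLR // ltnS -eqn_leq eq_sym.
by rewrite inE /rown /coln !interval.
Qed.

Lemma mem_block_version F p :
  (p \in block_version m F) = ((block_index p.1, block_index p.2) \in F).
Proof.
apply/bigcupP/idP => [[[l a] laF] | inF].
  by rewrite (mem_block l a) => /andP[/eqP/block_index_eq-> /eqP/block_index_eq->].
by exists (block_index p.1, block_index p.2); rewrite // mem_block !eqxx.
Qed.

Lemma block_version_ferrers F : ferrers F -> ferrers (block_version m F).
Proof.
move=> ferF; split=> p q; rewrite !mem_block_version /rown /coln => inF row col;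
  apply: ferrers_closed ferF inF _ _ => /=; apply: leq_div2r; lia.
Qed.

Lemma block_corner_proof (l : 'I_s) : l * m < s * m.
Proof. by rewrite ltn_mul2r m_gt0 ltn_ord. Qed.

(** Top-left cells serve as witnesses that blocks are nonempty and pairwise
distinct. *)
Definition block_corner (l : 'I_s) : 'I_(s * m) := Ordinal (block_corner_proof l).

Lemma block_cornerK : cancel block_corner block_index.
Proof. by move=> l; apply: val_inj; rewrite /= mulnK. Qed.

Lemma sub_block_version F (l a : 'I_s) :
  (block m s l.+1 a.+1 \subset block_version m F) = ((l, a) \in F).
Proof.
apply/subsetP/idP => [sub | laF p].
  have := sub (block_corner l, block_corner a).
  by rewrite mem_block mem_block_version /= !block_cornerK !mulnK // !eqxx; apply.
rewrite (mem_block l a) mem_block_version.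
by case/andP=> /eqP/block_index_eq-> /eqP/block_index_eq->.
Qed.

Lemma block_version_block_ferrers F :
  ferrers F -> block_ferrers (block_version m F).
Proof.
move=> ferF; split; first exact: block_version_ferrers.
case=> // i [|j] // /= lt_is lt_js.
pose l := Ordinal lt_is; pose a := Ordinal lt_js.
have [laF | laNF] := boolP ((l, a) \in F); [right | left].
  by apply/setIidPl; rewrite (sub_block_version F l a).
apply/setP=> p; rewrite in_setI in_set0.
rewrite (mem_block l a) mem_block_version; apply/negP.
by case/andP => /andP[/eqP/block_index_eq-> /eqP/block_index_eq->]; apply/negP.
Qed.

Lemma colsize_block_version F (x : 'I_(s * m)) :
  ferrers F ->
  colsize (block_version m F) x.+1 = m * colsize F (x %/ m).+1.
Proof.
move=> ferF; rewrite colsizeE; apply: card_ord_ltn => [|y].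
  by rewrite mulnC leq_mul2r (colsize_le F (block_index x)) orbT.
by rewrite inE mem_block_version mem_ferrers //= [m * _]mulnC -ltn_divLR.
Qed.

Lemma card_block_diag F i :
  ferrers F -> i <= s ->
  #|block_diag m s i :&: block_set (block_version m F)|
  = #|grid_diag s i :&: F|.
Proof.
move=> ferF i_le_s; rewrite card_grid_diag //.
have rowP (l : 'I_i) : l < s by apply: leq_trans (ltn_ord l) _.
have colP (l : 'I_i) : s - i + l < s by have := ltn_ord l; lia.
pose row l := Ordinal (rowP l); pose col l := Ordinal (colP l).
pose B l := block m s (row l).+1 (col l).+1.
have B_inj : injective B.
  move=> l l' eqB; apply: val_inj.
  have : (block_corner (row l), block_corner (col l)) \in B l'.
    by rewrite -eqB mem_block /= !mulnK // !eqxx.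
  by rewrite mem_block /= mulnK // => /andP[/eqP].
have -> : block_diag m s i :&: block_set (block_version m F)
          = B @: [set l | (row l, col l) \in F].
  apply/setP=> K; rewrite inE; apply/andP/imsetP => [[] | [l]].
    case/imsetP=> l _ ->{K}; rewrite addnS => /imsetP[b]; rewrite inE => bF eqB.
    exists l => //; rewrite inE -sub_block_version.
    by move: bF; rewrite -eqB.
  rewrite inE => lF ->; split; apply/imsetP; first by exists l; rewrite ?addnS.
  by exists (row l, col l); rewrite // inE sub_block_version.
rewrite card_imset // -sum1dep_card big_mkcond.
by apply: eq_bigr => l _; rewrite mem_ferrers //=; case: (_ < _).
Qed.

(** The column heights of the block version are m times those of the diagram, and
constant on the m columns of each block column. *)
Lemma nu_block_version F d J :
  ferrers F -> J < d ->
  nu (block_version m F) d J =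
  \sum_(a < s) (m - (J - (s - a.+1) * m)) * (m * colsize F a.+1 - (d - 1 - J)).
Proof.
move=> ferF Jd; rewrite /nu big_add1 big_mkord /=.
rewrite -(sum_first_columns s J (fun a => m * colsize F a.+1 - (d - 1 - J))) //.
apply: eq_bigr => x _.
have x_lt : x < s * m by apply: leq_trans (ltn_ord x) (leq_subr _ _).
by rewrite (colsize_block_version (Ordinal x_lt)) //=; lia.
Qed.

End BlockVersion.

(** * The lower bound from block diagonals *)

(** Split the surviving cells first into blocks, where a block keeps the product
of its numbers of remaining rows and columns, then along the block diagonals,
and apply [diagonal_inequality] to each of them. *)
Lemma diagonal_lower_bound (m s : nat) (F : {set cell s}) (d J : nat) :
  0 < m -> ferrers F -> J < d ->
  m * \sum_(i < s) (m * #|grid_diag s i.+1 :&: F| - (d - 1))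
  <= nu (block_version m F) d J.
Proof.
move=> m_gt0 ferF Jd; rewrite nu_block_version //.
pose U := d - 1 - J; rewrite -/U.
pose h l a := (l < colsize F a.+1) * ((m - (J - (s - a.+1) * m)) * (m - (U - l * m))).
have column (a : 'I_s) :
    (m - (J - (s - a.+1) * m)) * (m * colsize F a.+1 - U) = \sum_(l < s) h l a.
  rewrite mulnC [m * _]mulnC -(sum_trunc_steps m U) mulnC big_distrr /=.
  rewrite (big_ord_widen s (fun l => (m - (J - (s - a.+1) * m)) * (m - (U - l * m)))).
    by rewrite big_mkcond; apply: eq_bigr => l _; rewrite /h; case: ifP; rewrite ?mul1n.
  exact: colsize_le.
under [leqRHS]eq_bigr => a _ do rewrite column.
apply: leq_trans (sum_over_diagonals s h); rewrite big_distrr /=.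
apply: leq_sum => i _; rewrite card_grid_diag //.
have := @diagonal_inequality m U J i.+1 (fun l => l < colsize F (s - i.+1 + l).+1).
have -> : \sum_(l < i.+1) h l (s - i.+1 + l) =
    \sum_(l < i.+1) (l < colsize F (s - i.+1 + l).+1) *
       ((m - (J - (i.+1 - l.+1) * m)) * (m - (U - l * m))).
  apply: eq_bigr => l _; rewrite /h.
  rewrite (_ : s - (s - i.+1 + l).+1 = i.+1 - l.+1) //.
  by have := ltn_ord l; have := ltn_ord i; lia.
rewrite (_ : U + J = d - 1); last by rewrite /U; lia.
by move=> bound; rewrite [leqLHS]mulnBr leq_subLR addnC.
Qed.

(** * Triangular covered diagrams *)

Lemma sum_geq_ord (n k : nat) : \sum_(x < n) (k <= x) = n - k.
Proof.
elim: n => [|n IHn]; first by rewrite big_ord0.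
by rewrite big_ord_recr /= IHn; lia.
Qed.

Section TriangularCover.
Variable n : nat.
Implicit Types (G : {set cell n}) (p : cell n).

Lemma lt_grid_col G p : ferrers G -> p \in G -> p.1 < #|grid_col n n :&: G|.
Proof.
case: n G p => [|n'] G p ferG pG; first by case: p {pG} => [[]].
rewrite -[#|_|]/(colsize G (@ord_max n').+1).
rewrite -(mem_ferrers (p.1, ord_max) ferG).
by apply: ferrers_closed pG _ _ => //=; rewrite -ltnS.
Qed.

Lemma card_grid_row1 (n' : nat) (G : {set cell n'.+1}) :
  #|grid_row n'.+1 1 :&: G| = \sum_(a < n'.+1) ((ord0, a) \in G).
Proof.
apply: card_cells => [x y []//|p|a]; last by rewrite inE.
rewrite inE /rown => /eqP[p0]; exists p.2.
by case: p p0 => l a /= l0; congr pair; apply: val_inj.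
Qed.

Lemma leq_grid_row G p : ferrers G -> p \in G -> n - p.2 <= #|grid_row n 1 :&: G|.
Proof.
case: n G p => [|n'] G p ferG pG; first by case: p {pG} => [[]].
rewrite card_grid_row1 -sum_geq_ord; apply: leq_sum => a _.
case: (leqP p.2 a) => // pa; rewrite (_ : _ \in G) //.
exact: ferrers_closed pG _ _.
Qed.

(** The inequality places the cell inside the triangle of side [min_order G] at
the top-right corner of the big grid.  No cell is lost in the standard version,
because the first row and the last column of a Ferrers diagram bound its width
and height. *)
Lemma triangular_coveredP G p :
  ferrers G -> triangular_covered G -> p \in G ->
  p.1 + (n - min_order G) <= p.2.
Proof.
move=> ferG tri pG; case: tri => [G0 | tri]; first by rewrite G0 inE in pG.
have colG := lt_grid_col ferG pG; have rowG := leq_grid_row ferG pG.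
have [row_o col_o] : p.1 < min_order G /\ n - p.2 <= min_order G.
  by rewrite /min_order !leq_max colG rowG orbT.
have p2n := ltn_ord p.2.
have q2_lt : p.2 - (n - min_order G) < min_order G by lia.
have : (Ordinal row_o, Ordinal q2_lt) \in standard_version G.
  rewrite inE; apply/existsP; exists p.
  by rewrite pG /rown /coln /= eqxx; apply/eqP; lia.
by move/(subsetP tri); rewrite inE /rown /coln /=; lia.
Qed.

End TriangularCover.

(** * Deleting rows and columns *)

Section Survivors.
Variables (s : nat) (F : {set cell s}) (delta j : nat).
Hypothesis ferF : ferrers F.
Hypothesis j_lt : j < delta.
Hypothesis delta_le : delta <= s.

Let e := delta - 1 - j.

Lemma nu_sum : nu F delta j = \sum_(a < s) (a < s - j) * (colsize F a.+1 - e).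
Proof.
rewrite /nu big_add1 big_mkord /=.
rewrite (big_ord_widen s (fun a => colsize F a.+1 + 1 + j - delta)) ?leq_subr //.
rewrite big_mkcond; apply: eq_bigr => a _.
by case: ifP => _; rewrite ?mul1n /e //; lia.
Qed.

(** Undoing the translation turns the region into two inequalities. *)
Lemma mem_shifted_S (q : cell s) :
  (q \in shifted_S F delta j) =
  (j <= q.2) && (q.1 + e < colsize F (q.2 - j).+1).
Proof.
case: q => x y; rewrite inE; apply/existsP/andP => /= [[[l a]] | [jy xc]].
  rewrite !inE /rown /coln /= => /andP[/andP[laF regp] /andP[/eqP xl /eqP ya]].
  rewrite mem_ferrers //= in laF.
  rewrite (_ : y - j = a); last by lia.
  by split; [lia | apply: leq_ltn_trans laF; rewrite /e; lia].
have y_lt : y - j < s by apply: leq_ltn_trans (leq_subr _ _) (ltn_ord _).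
have x_lt : x + e < s by apply: leq_trans xc (colsize_le F (Ordinal y_lt)).
exists (Ordinal x_lt, Ordinal y_lt); rewrite inE mem_ferrers //= xc /=.
have := ltn_ord y; rewrite inE /rown /coln /= /e; lia.
Qed.

Lemma shifted_S_ferrers : ferrers (shifted_S F delta j).
Proof.
split=> -[x y] [x' y']; rewrite !mem_shifted_S /rown /coln /= => /andP[jy xc] row col.
  have y_lt : y - j < s by apply: leq_ltn_trans (leq_subr _ _) (ltn_ord _).
  have y'_lt : y' - j < s by apply: leq_ltn_trans (leq_subr _ _) (ltn_ord _).
  have := @colsize_homo _ F (Ordinal y_lt) (Ordinal y'_lt) ferF.
  by move=> /=; lia.
have -> : nat_of_ord y' = y by lia.
by lia.
Qed.

(** The translation brings to the top row the cells of row e + 1 of F lying in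
columns 1, ..., s - j, and to the last column those of column s - j of F lying
below row e. *)
Lemma min_order_shifted_S :
  min_order (shifted_S F delta j) =
  maxn (\sum_(a < s) (a < s - j) * (e < colsize F a.+1)) (colsize F (s - j) - e).
Proof.
rewrite /min_order; congr maxn.
  move: mem_shifted_S; rewrite /e; case: s F delta_le => [|s'] F' dle memG; first by lia.
  rewrite card_grid_row1.
  have js : j <= s'.+1 by lia.
  under eq_bigr => a _ do rewrite memG /= add0n.
  have split_at (f : nat -> nat) :
      \sum_(a < s'.+1) f a = \sum_(a < j) f a + \sum_(a < s'.+1 - j) f (j + a).
    by move: (subnKC js); move: (s'.+1 - j) => k <-; rewrite big_split_ord.
  rewrite (split_at (fun a => (j <= a) && (delta - 1 - j < colsize F' (a - j).+1))).
  rewrite big1 ?add0n => [|a _]; last by rewrite leqNgt ltn_ord.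
  rewrite [RHS](bigID (fun a : 'I_s'.+1 => a < s'.+1 - j)) /= [X in _ + X]big1 ?addn0.
    rewrite -(big_ord_widen s'.+1
      (fun a => (a < s'.+1 - j) * (delta - 1 - j < colsize F' a.+1))) ?leq_subr //.
    by apply: eq_bigr => a _; rewrite ltn_ord mul1n leq_addr /= addKn.
  by move=> a /negPf ->.
have last_lt : s.-1 < s by lia.
rewrite (_ : #|_| = colsize (shifted_S F delta j) (Ordinal last_lt).+1); last first.
  by rewrite /colsize /= (ltn_predK last_lt).
rewrite colsizeE; apply: card_ord_ltn => [|l].
  have c_lt : s - j - 1 < s by lia.
  have := colsize_le F (Ordinal c_lt); rewrite /= (_ : (s - j - 1).+1 = s - j); lia.
rewrite inE mem_shifted_S /= (_ : (s.-1 - j).+1 = s - j); lia.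
Qed.

(** Each of the e deleted rows and j deleted columns removes at most one cell from
a diagonal, which is [diagonal_inequality] for blocks of side 1; fewer than
delta cells are lost.  The translation moves the survivor delta - 1 diagonals
towards the corner. *)
Lemma long_diagonal_survivor i :
  i < s -> delta <= #|grid_diag s i.+1 :&: F| ->
  exists2 q : cell s, q \in shifted_S F delta j &
    q.2 + i = q.1 + (s - 1) + (delta - 1).
Proof.
move=> i_lt; rewrite card_grid_diag // => long.
have := @diagonal_inequality 1 e j i.+1 (fun l => l < colsize F (s - i.+1 + l).+1).
rewrite !mul1n => bound.
have : 0 < \sum_(l < i.+1) (l < colsize F (s - i.+1 + l).+1) *
    ((1 - (j - (i.+1 - l.+1) * 1)) * (1 - (e - l * 1))).
  by move: bound long; rewrite /e; lia.
rewrite lt0n sum_nat_eq0 => /forallPn[l]; rewrite /= -lt0n !muln_gt0 !muln1.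
case/andP => in_F /andP[jl el].
have l_le := ltn_ord l.
have q1_lt : l - e < s by lia.
have q2_lt : s - i.+1 + l + j < s by lia.
exists (Ordinal q1_lt, Ordinal q2_lt); last by move: el; rewrite /= /e; lia.
rewrite mem_shifted_S /= addnK leq_addl /=.
by move: in_F; case: (_ < _) / idP => // + _; rewrite subnK //; lia.
Qed.

(** The index of a long diagonal, counted from 0, lies in a window of length o:
it is at least delta - 1, as shorter diagonals have fewer than delta cells, and
it is less than delta - 1 + o by the position of its survivor. *)
Lemma count_long_diagonals :
  (delta = s \/ triangular_covered (shifted_S F delta j)) ->
  \sum_(i < s) (delta <= #|grid_diag s i.+1 :&: F|)
  <= min_order (shifted_S F delta j).
Proof.
move=> hyp; set o := min_order _.
apply: (@leq_trans (\sum_(i < s) (delta - 1 <= i < delta - 1 + o))).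
  apply: leq_sum => i _; case: (leqP delta) => // long.
  have [q qG diag_q] := long_diagonal_survivor (ltn_ord i) long.
  rewrite lt0b; have := ltn_ord q.2; have := ltn_ord i => i_lt q2_lt.
  apply/andP; split; first by lia.
  (* If delta = s, then i = s - 1 and the window only has to be nonempty. *)
  case: hyp => [delta_s | tri].
    have : q.1 < o.
      apply: leq_trans (lt_grid_col shifted_S_ferrers qG) _.
      exact: leq_maxr.
    by lia.
  have := triangular_coveredP shifted_S_ferrers tri qG; rewrite -/o; lia.
have window k : \sum_(i < k) (delta - 1 <= i < delta - 1 + o) = minn (k - (delta - 1)) o.
  elim: k => [|k IHk]; first by rewrite big_ord0 sub0n min0n.
  by rewrite big_ord_recr /= IHk; lia.
by rewrite window geq_minr.
Qed.

(** Every column of height c > e among the first s - j loses r further cells in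
each of its m copies. *)
Lemma nu_block_rows (m r : nat) :
  0 < m -> r <= m ->
  nu (block_version m F) (m * (delta - 1) + r).+1 (m * j)
  + m * (r * \sum_(a < s) (a < s - j) * (e < colsize F a.+1))
  = m * (m * nu F delta j).
Proof.
move=> m_gt0 r_le.
have eE : delta - 1 = e + j by rewrite /e; lia.
rewrite nu_block_version //; last by rewrite eE mulnDr; lia.
rewrite nu_sum !big_distrr /= -big_split /=; apply: eq_bigr => a _.
rewrite eE (_ : (m * (e + j) + r).+1 - 1 - m * j = m * e + r); last by lia.
have a_lt := ltn_ord a; set c := colsize F a.+1.
case: ltnP => a_j /=; last first.
  rewrite !mul0n !muln0 addn0.
  rewrite (_ : m - _ = 0) //; apply/eqP; rewrite subn_eq0.
  have : (s - a.+1).+1 * m <= j * m by rewrite leq_mul2r; lia.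
  by rewrite mulSn mulnC; lia.
rewrite (_ : m * j - _ = 0); last first.
  by apply/eqP; rewrite subn_eq0 mulnC leq_mul2r; lia.
rewrite subn0 -mulnDr !mul1n; congr (_ * _).
case: ltnP => ec /=; last first.
  have : m * c <= m * e by rewrite leq_mul2l ec orbT.
  by rewrite (_ : c - e = 0) ?muln0; lia.
have -> : c = e + (c - e.+1).+1 by lia.
by rewrite addKn muln1 mulnDr mulnS; move: (m * (c - _)) => w; lia.
Qed.

(** The r extra columns are copies of column s - j, each of which had
m * (colsize F (s - j) - e) surviving cells. *)
Lemma nu_block_columns (m r : nat) :
  0 < m -> r <= m ->
  nu (block_version m F) (m * (delta - 1) + r).+1 (m * j + r)
  + m * (r * (colsize F (s - j) - e))
  = m * (m * nu F delta j).
Proof.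
move=> m_gt0 r_le.
have eE : delta - 1 = e + j by rewrite /e; lia.
have -> : colsize F (s - j) - e =
    \sum_(a < s) (a.+1 == s - j) * (colsize F a.+1 - e).
  have last_lt : s - j - 1 < s by lia.
  rewrite (bigD1 (Ordinal last_lt)) //= big1 => [|a /eqP neq].
    by rewrite (_ : (s - j - 1).+1 = s - j) ?eqxx ?mul1n ?addn0 //; lia.
  case: eqP => // a_last; case: neq; apply: val_inj => /=; lia.
rewrite nu_block_version //; last by rewrite eE mulnDr; lia.
rewrite nu_sum !big_distrr /= -big_split /=; apply: eq_bigr => a _.
rewrite eE (_ : (m * (e + j) + r).+1 - 1 - (m * j + r) = m * e); last by lia.
have a_lt := ltn_ord a; rewrite -mulnBr; set x := _ - e.
(* The block column s - j keeps m - r of its m columns, those to its left all of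
   them, and those to its right none. *)
have -> : m - (m * j + r - (s - a.+1) * m)
          = m * (a < s - j) - r * (a.+1 == s - j).
  case: eqP => [a_last | a_neq].
    have -> : s - a.+1 = j by lia.
    have -> : a < s - j by lia.
    by rewrite [j * m]mulnC addKn !muln1.
  rewrite muln0 subn0; case: ltnP => a_j /=.
    have : j.+1 * m <= (s - a.+1) * m by rewrite leq_mul2r; lia.
    by rewrite mulSn [j * m]mulnC; lia.
  have : (s - a.+1).+1 * m <= j * m by rewrite leq_mul2r; lia.
  by rewrite mulSn [j * m]mulnC; lia.
case: eqP => [a_last | _] /=; last first.
  by rewrite !muln0 addn0 subn0 -mulnA [_ * (m * x)]mulnCA.
rewrite (_ : a < s - j) ?muln1 ?mul1n; last by lia.
by rewrite [m * (r * x)]mulnCA -mulnDl subnK.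
Qed.

End Survivors.

(** * Comparing the two bounds *)

(** Here m D - (m k + r) = m (D - k) - r as soon as D > k. *)
Lemma sum_excess_blocks (m r k s : nat) (D : nat -> nat) :
  r <= m ->
  \sum_(i < s) (m * D i - (m * k + r)) + r * \sum_(i < s) (k < D i)
  = m * \sum_(i < s) (D i - k).
Proof.
move=> r_le; rewrite !big_distrr -big_split /=; apply: eq_bigr => i _.
case: (ltnP k (D i)) => kD /=.
  have -> : D i = k + (D i - k.+1).+1 by lia.
  rewrite addKn muln1 mulnDr mulnS; move: (m * (_ - _)) => w; lia.
have : m * D i <= m * k by rewrite leq_mul2l kD orbT.
rewrite (_ : D i - k = 0) ?muln0; lia.
Qed.

(** The extra r lines are taken to be columns or rows according to which of the
two sides of the surviving diagram is the longer one. *)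
Lemma nu_min_block_le (m s : nat) (F : {set cell s}) (delta j r : nat) :
  0 < m -> r < m -> ferrers F -> j < delta <= s ->
  nu_min (block_version m F) (m * (delta - 1) + r).+1
  + m * (r * min_order (shifted_S F delta j))
  <= m * (m * nu F delta j).
Proof.
move=> m_gt0 r_lt ferF /andP[j_lt delta_le]; have r_le := ltnW r_lt.
have dE : m * (delta - 1) = m * j + m * (delta - 1 - j) by rewrite -mulnDr subnKC //; lia.
rewrite min_order_shifted_S // /maxn; case: ifP => _.
  rewrite -(nu_block_columns ferF j_lt delta_le m_gt0 r_le) leq_add2r.
  by apply: nu_min_le; lia.
rewrite -(nu_block_rows ferF j_lt delta_le m_gt0 r_le) leq_add2r.
by apply: nu_min_le; lia.
Qed.

Theorem theorem4p23 (m s : nat) (F : {set cell s}) (delta d r : nat)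
    (hm : 1 <= m) (hs : 1 <= s) (hF : ferrers F)
    (hdelta : 1 <= delta <= s) (hd : 1 <= d <= s * m)
    (hr : 1 <= r <= m - 1) (hdr : d - 1 = m * (delta - 1) + r)
    (hMDS : MDS_constructible F delta)
    (hcase :
      delta = s \/
      (delta <= s - 1 /\
       exists j : nat,
         [/\ j <= delta - 1,
             singleton F delta j,
             singleton F delta.+1 j \/ singleton F delta.+1 j.+1
           & triangular_covered (shifted_S F delta j)])) :
  MSRD_constructible (block_version m F) d.
Proof.
split; first exact: block_version_block_ferrers.
have /andP[delta_gt0 delta_le] := hdelta.
pose D i := #|grid_diag s i :&: F|.
have -> : \sum_(1 <= i < s.+1)
      (m * #|block_diag m s i :&: block_set (block_version m F)| + 1 - d)
    = \sum_(i < s) (m * D i.+1 - (d - 1)).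
  rewrite big_add1 big_mkord; apply: eq_bigr => i _.
  rewrite card_block_diag // /D; move: (m * _) => w; lia.
apply/eqP; rewrite eqn_leq; apply/andP; split; last first.
  have d_gt0 : 0 < d by case/andP: hd.
  have [J Jd ->] := nu_min_attained (block_version m F) d_gt0.
  exact: diagonal_lower_bound.
have [j [j_lt nu_j cover]] : exists j, [/\ j < delta, nu_min F delta = nu F delta j
    & delta = s \/ triangular_covered (shifted_S F delta j)].
  case: hcase => [delta_s | [_ [j [_ [j_lt nu_j] _ tri]]]]; last by exists j; split; auto.
  have [j j_lt nu_j] := nu_min_attained F delta_gt0.
  by exists j; split; auto.
have long_le := count_long_diagonals hF j_lt delta_le cover.
have r_lt : r < m by lia.
have upper : nu_min (block_version m F) d
    + m * (r * min_order (shifted_S F delta j)) <= m * (m * nu F delta j).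
  rewrite (_ : d = (m * (delta - 1) + r).+1); last by lia.
  by apply: nu_min_block_le; rewrite ?j_lt.
have MDS_sum : nu F delta j = \sum_(i < s) (D i.+1 - (delta - 1)).
  rewrite -nu_j hMDS big_add1 big_mkord; apply: eq_bigr => i _.
  by rewrite /D; move: #|_| => w; lia.
have excess := @sum_excess_blocks m r (delta - 1) s (fun i => D i.+1) (ltnW r_lt).
move: upper; rewrite MDS_sum -excess hdr mulnDr => upper.
rewrite -(leq_add2r (m * (r * min_order (shifted_S F delta j)))).
apply: leq_trans upper _; rewrite leq_add2l !leq_mul2l.
apply/orP; right; apply/orP; right; apply: leq_trans long_le.
by apply: leq_sum => i _; rewrite -/(D _) subn1 prednK.
Qed.
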